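(* Let $\tau>0$ and let $\gamma:I\to \mathrm{SL}(2,\mathbb{R})_\tau\subset\mathbb{R}^4_2$ be a proper biharmonic curve parametrized by arc length, with $\gamma'(s)=\cos\vartheta\,E_1+\sin\vartheta\sin\beta(s)\,E_2+\sin\vartheta\cos\beta(s)\,E_3$, where $\vartheta\in(0,\pi/2]$ is constant and $\beta:I\to\mathbb{R}$ is smooth. Let $b=\beta'$ and $a=\frac12\big(-\tau^{-2}+1-(1+\tau^{-2})\cos2\vartheta\big)-\tau^{-1}\cos\vartheta\,\beta'$ (these are constant along $\gamma$), and suppose that $b^2=4a$. Then $$b=-\tau^{-1}(2+\tau^2)\cos\vartheta+\sqrt{(4+5\tau^2)\cos^2\vartheta-4(1+\tau^2)},\qquad\text{with}\qquad \cos^2\vartheta=\frac{(2+\tau^2)^2}{4+5\tau^2+\tau^4}.$$ Also, $$\gamma(s)=A\Big(\cos(\sqrt a\,s)+g_{14}\,s\sin(\sqrt a\,s),\ -\sin(\sqrt a\,s)+g_{14}\,s\cos(\sqrt a\,s),\ -g_{14}\,s\cos(\sqrt a\,s),\ g_{14}\,s\sin(\sqrt a\,s)\Big),$$ where $g_{14}$ is the constant given by $$g_{14}=\frac{\tau}{\sqrt{4+5\tau^2+\tau^4}}$$ and $A\in \mathrm{O}_2(4)$ is some $4\times4$ indefinite orthogonal (constant) matrix which commutes with $J_1$.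
   Context: Let $\mathbb{R}^4_2$ be $\mathbb{R}^4$ with the inner product $\langle v,w\rangle=v_1w_1+v_2w_2-v_3w_3-v_4w_4$; identify $\mathbb{R}^4$ with $\mathbb{C}^2$ via $(z,w)=(x_1+ix_2,x_3+ix_4)$, and identify $\mathrm{SL}(2,\mathbb{R})$ with $\{(z,w)\in\mathbb{C}^2: |z|^2-|w|^2=1\}=\{v\in\mathbb{R}^4_2:\langle v,v\rangle=1\}$. On it consider the tangent vector fields $$X_1(z,w)=(iz,iw),\quad X_2(z,w)=(i\bar w,i\bar z),\quad X_3(z,w)=(\bar w,\bar z).$$ For $\tau>0$, $\mathrm{SL}(2,\mathbb{R})_\tau$ denotes $\mathrm{SL}(2,\mathbb{R})$ with the Riemannian metric $g_\tau(X,Y)=-\langle X,Y\rangle+(1+\tau^2)\langle X,X_1\rangle\langle Y,X_1\rangle$. Then $E_1=-\tau^{-1}X_1$, $E_2=X_2$, $E_3=X_3$ is a global orthonormal frame (evaluated at $\gamma(s)$ in formulas for $\gamma'(s)$). Let $\nabla^\tau$ be the Levi-Civita connection of $g_\tau$ and $R(X,Y)Z=\nabla^\tau_X\nabla^\tau_YZ-\nabla^\tau_Y\nabla^\tau_XZ-\nabla^\tau_{[X,Y]}Z$ its curvature. Curves are smooth and defined on an open interval $I$. A curve $\gamma$ parametrized by arc length, with $T=\gamma'$, is biharmonic if its bitension field vanishes, i.e. $(\nabla^\tau_T)^3T-R(T,\nabla^\tau_TT)T=0$; it is proper biharmonic if it is biharmonic and not a geodesic. $J_1=\begin{pmatrix}J&0\\0&J\end{pmatrix}$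 with $J=\begin{pmatrix}0&-1\\1&0\end{pmatrix}$, and $\mathrm{O}_2(4)=\{A\in\mathrm{GL}(4,\mathbb{R}):A^t=\epsilon A^{-1}\epsilon\}$ with $\epsilon=\mathrm{diag}(1,1,-1,-1)$. $A$ acts on the coordinate vector as a column vector. *)

(* Defs.v *)
From mathcomp Require Import all_boot all_order all_algebra.
From mathcomp Require Import all_classical all_reals all_analysis.

Set Implicit Arguments.
Unset Strict Implicit.
Unset Printing Implicit Defensive.

Import Order.TTheory GRing.Theory Num.Theory.
Import numFieldNormedType.Exports.

Local Open Scope ring_scope.
Local Open Scope classical_set_scope.

(* Points of R^4, identified with C^2 by (z, w) = (x1 + i x2, x3 + i x4). *)
Definition vec4 (R : realType) (a b c d : R) : 'cV[R]_4 :=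
  \col_(i < 4) nth 0 [:: a; b; c; d] i.

Definition x1 (R : realType) (v : 'cV[R]_4) : R := v (@Ordinal 4 0 isT) ord0.
Definition x2 (R : realType) (v : 'cV[R]_4) : R := v (@Ordinal 4 1 isT) ord0.
Definition x3 (R : realType) (v : 'cV[R]_4) : R := v (@Ordinal 4 2 isT) ord0.
Definition x4 (R : realType) (v : 'cV[R]_4) : R := v (@Ordinal 4 3 isT) ord0.

Definition inner (R : realType) (v w : 'cV[R]_4) : R :=
  x1 v * x1 w + x2 v * x2 w - x3 v * x3 w - x4 v * x4 w.

Definition SL2 (R : realType) : set 'cV[R]_4 := [set v | inner v v = 1].

(* In complex coordinates, with ~ for conjugation:
   X1 (z, w) = (i z, i w), X2 (z, w) = (i ~w, i ~z), X3 (z, w) = (~w, ~z). *)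
Definition X1 (R : realType) (p : 'cV[R]_4) : 'cV[R]_4 :=
  vec4 (- x2 p) (x1 p) (- x4 p) (x3 p).
Definition X2 (R : realType) (p : 'cV[R]_4) : 'cV[R]_4 :=
  vec4 (x4 p) (x3 p) (x2 p) (x1 p).
Definition X3 (R : realType) (p : 'cV[R]_4) : 'cV[R]_4 :=
  vec4 (x3 p) (- x4 p) (x1 p) (- x2 p).

Definition metric (R : realType) (tau : R) (p u v : 'cV[R]_4) : R :=
  - inner u v + (1 + tau ^+ 2) * (inner u (X1 p) * inner v (X1 p)).

Definition E1 (R : realType) (tau : R) (p : 'cV[R]_4) : 'cV[R]_4 :=
  - tau^-1 *: X1 p.
Definition E2 (R : realType) (p : 'cV[R]_4) : 'cV[R]_4 := X2 p.
Definition E3 (R : realType) (p : 'cV[R]_4) : 'cV[R]_4 := X3 p.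

Definition frame (R : realType) (tau : R) (i : 'I_3) :
    'cV[R]_4 -> 'cV[R]_4 :=
  nth (@E3 R) [:: E1 tau; @E2 R; @E3 R] i.

(* C^oo maps on R^4: all iterated directional derivatives exist and are Frechet
   differentiable everywhere. *)
Fixpoint ndiff (R : realType) (W : normedModType R) (k : nat)
    (f : 'cV[R]_4 -> W) : Prop :=
  if k is k'.+1 then
    (forall p, differentiable f p) /\ (forall v, ndiff k' ('D_v f))
  else True.

Definition smooth (R : realType) (W : normedModType R) (f : 'cV[R]_4 -> W) :
    Prop :=
  forall k, ndiff k f.

(* SL(2,R) is a closed submanifold of R^4, so its smooth functions and smooth
   tangent fields are exactly the restrictions of smooth maps on R^4.  They are
   represented here by such extensions; two fields are the same when they agree
   on SL(2,R), and a derivative at a point of SL(2,R) along a tangent vector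
   depends only on the restriction.  The tangent space at p is the orthogonal
   of p for the indefinite inner product. *)
Definition vfield (R : realType) (X : 'cV[R]_4 -> 'cV[R]_4) : Prop :=
  smooth X /\ forall p, SL2 p -> inner p (X p) = 0.

Definition eq_on_SL2 (R : realType) (X Y : 'cV[R]_4 -> 'cV[R]_4) : Prop :=
  forall p, SL2 p -> X p = Y p.

Definition lie (R : realType) (X Y : 'cV[R]_4 -> 'cV[R]_4) (p : 'cV[R]_4) :
    'cV[R]_4 :=
  'D_(X p) Y p - 'D_(Y p) X p.

Record levi_civita (R : realType) (tau : R)
    (nabla : ('cV[R]_4 -> 'cV[R]_4) -> ('cV[R]_4 -> 'cV[R]_4) ->
             'cV[R]_4 -> 'cV[R]_4) : Prop := LeviCivita {
  lc_vfield : forall X Y, vfield X -> vfield Y -> vfield (nabla X Y);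
  lc_ext : forall X X' Y Y', vfield X -> vfield X' -> vfield Y -> vfield Y' ->
    eq_on_SL2 X X' -> eq_on_SL2 Y Y' -> eq_on_SL2 (nabla X Y) (nabla X' Y');
  lc_addl : forall X X' Y, vfield X -> vfield X' -> vfield Y ->
    eq_on_SL2 (nabla (fun q => X q + X' q) Y)
              (fun p => nabla X Y p + nabla X' Y p);
  lc_scalel : forall (f : 'cV[R]_4 -> R) X Y,
    smooth f -> vfield X -> vfield Y ->
    eq_on_SL2 (nabla (fun q => f q *: X q) Y) (fun p => f p *: nabla X Y p);
  lc_addr : forall X Y Y', vfield X -> vfield Y -> vfield Y' ->
    eq_on_SL2 (nabla X (fun q => Y q + Y' q))
              (fun p => nabla X Y p + nabla X Y' p);
  lc_leibniz : forall (f : 'cV[R]_4 -> R) X Y,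
    smooth f -> vfield X -> vfield Y ->
    eq_on_SL2 (nabla X (fun q => f q *: Y q))
              (fun p => 'D_(X p) f p *: Y p + f p *: nabla X Y p);
  lc_torsion_free : forall X Y, vfield X -> vfield Y ->
    eq_on_SL2 (fun p => nabla X Y p - nabla Y X p) (lie X Y);
  lc_metric : forall X Y Z, vfield X -> vfield Y -> vfield Z ->
    forall p, SL2 p ->
      'D_(X p) (fun q => metric tau q (Y q) (Z q)) p =
      metric tau p (nabla X Y p) (Z p) + metric tau p (Y p) (nabla X Z p)
}.

(* The field with constant coefficients in the frame whose value at p is v. *)
Definition frame_ext (R : realType) (tau : R) (p v q : 'cV[R]_4) : 'cV[R]_4 :=
  \sum_(i < 3) metric tau p v (frame tau i p) *: frame tau i q.

Definition curvature (R : realType) (tau : R)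
    (nabla : ('cV[R]_4 -> 'cV[R]_4) -> ('cV[R]_4 -> 'cV[R]_4) ->
             'cV[R]_4 -> 'cV[R]_4)
    (p u v w : 'cV[R]_4) : 'cV[R]_4 :=
  let X := frame_ext tau p u in
  let Y := frame_ext tau p v in
  let Z := frame_ext tau p w in
  nabla X (nabla Y Z) p - nabla Y (nabla X Z) p - nabla (lie X Y) Z p.

(* Covariant derivative along gamma of a field V = sum_i V_i E_i along gamma:
   sum_i (V_i' E_i + V_i nabla_(gamma') E_i). *)
Definition cov_along (R : realType) (tau : R)
    (nabla : ('cV[R]_4 -> 'cV[R]_4) -> ('cV[R]_4 -> 'cV[R]_4) ->
             'cV[R]_4 -> 'cV[R]_4)
    (gamma V : R -> 'cV[R]_4) (s : R) : 'cV[R]_4 :=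
  \sum_(i < 3)
    (derive1 (fun t => metric tau (gamma t) (V t) (frame tau i (gamma t))) s
       *: frame tau i (gamma s)
     + metric tau (gamma s) (V s) (frame tau i (gamma s))
       *: nabla (frame_ext tau (gamma s) (derive1 gamma s)) (frame tau i) (gamma s)).

Definition bitension (R : realType) (tau : R)
    (nabla : ('cV[R]_4 -> 'cV[R]_4) -> ('cV[R]_4 -> 'cV[R]_4) ->
             'cV[R]_4 -> 'cV[R]_4)
    (gamma : R -> 'cV[R]_4) (s : R) : 'cV[R]_4 :=
  let T := derive1 gamma in
  let D := cov_along tau nabla gamma in
  D (D (D T)) s - curvature tau nabla (gamma s) (T s) (D T s) (T s).

Definition smooth_on (R : realType) (W : normedModType R) (I : set R)
    (f : R -> W) : Prop :=
  forall n s, I s -> derivable (derive1n n f) s 1.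

Definition arc_length (R : realType) (tau : R) (I : set R)
    (gamma : R -> 'cV[R]_4) : Prop :=
  forall s, I s -> metric tau (gamma s) (derive1 gamma s) (derive1 gamma s) = 1.

Definition geodesic (R : realType) (tau : R)
    (nabla : ('cV[R]_4 -> 'cV[R]_4) -> ('cV[R]_4 -> 'cV[R]_4) ->
             'cV[R]_4 -> 'cV[R]_4)
    (I : set R) (gamma : R -> 'cV[R]_4) : Prop :=
  forall s, I s -> cov_along tau nabla gamma (derive1 gamma) s = 0.

Definition proper_biharmonic (R : realType) (tau : R)
    (nabla : ('cV[R]_4 -> 'cV[R]_4) -> ('cV[R]_4 -> 'cV[R]_4) ->
             'cV[R]_4 -> 'cV[R]_4)
    (I : set R) (gamma : R -> 'cV[R]_4) : Prop :=
  (forall s, I s -> bitension tau nabla gamma s = 0) /\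
  ~ geodesic tau nabla I gamma.

Definition J2 (R : realType) : 'M[R]_2 :=
  \matrix_(i < 2, j < 2) nth 0 (nth [::] [:: [:: 0; -1]; [:: 1; 0]] i) j.

Definition J1 (R : realType) : 'M[R]_4 :=
  block_mx (J2 R) 0 0 (J2 R) : 'M[R]_(2 + 2).

Definition epsilon (R : realType) : 'M[R]_4 :=
  diag_mx (\row_(i < 4) nth 0 [:: 1; 1; -1; -1] i).

Definition O24 (R : realType) : set 'M[R]_4 :=
  [set A | A \in unitmx /\ A^T = epsilon R *m invmx A *m epsilon R].

(* Main.v *)
From HB Require Import structures.
Require Import Defs.
From mathcomp Require Import all_boot all_order all_algebra.
From mathcomp Require Import all_classical all_reals all_analysis.
From mathcomp Require Import ring lra.
Import Order.TTheory GRing.Theory Num.Theory.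
Import numFieldNormedType.Exports.
Local Open Scope ring_scope.
Local Open Scope classical_set_scope.

(** The metric is left invariant and E1, E2, E3 is a left invariant orthonormal
    frame, so the axioms of the Levi-Civita connection determine it on fields
    with constant coefficients in this frame from the Lie brackets alone
    ([nabla_frame_field]); its curvature and the covariant derivatives along
    gamma are then explicit.  Put c = cos theta, sg = sin theta,
    m = 2 / tau + tau, and let N = cos beta E2 - sin beta E3.  One finds
    D T = k N with k = sg (beta' + c (m + tau)), and

    - the E1 component of the bitension field is - 2 tau sg^2 beta'', hence
      beta' is a constant b ([biharmonic_slope_cst]);
    - the N component is then a multiple of k, which is not zero because gamma
      is not a geodesic, and dividing by k leaves
      (b + m c)^2 = tau^2 c^2 - 4 (1 + tau^2) sg^2 ([biharmonic_slope_eq]).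

    The condition b^2 = 4 a reads (b + 2 c / tau)^2 = (2 sg)^2.  Combined with
    the previous equation and the signs c >= 0 and sg > 0, it leaves only
    tau c = (2 + tau^2) sg and b = - 2 r with r = c / tau + sg
    ([double_root_angle]).  All closed formulas for b and c^2 follow; moreover
    sqrt a = r and g14 = sg.

    In complex coordinates the curve satisfies
      z' = - i (c / tau) z + sg e^(i beta) conj w,
      w' = - i (c / tau) w + sg e^(i beta) conj z.
    Multiplying z and w by e^(i r s) makes the system autonomous, because
    beta + 2 r s is a constant phi.  The new coordinates, still called z and w,
    satisfy
      z' = sg (i z + e^(i phi) conj w),   w' = sg (i w + e^(i phi) conj z).
    The matrix of this system has square zero; this is where b^2 = 4 a, the
    coincidence of the two frequencies, enters.  So z and w are affine in s
    ([nilpotent_system]), say z = z0 + s z0' and w = w0 + s w0'.  The model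
    curve is the solution with z0 = 1, w0 = 0, phi = pi, and A is the complex
    matrix with columns (z0, w0) and - e^(i phi) (conj w0, conj z0), which
    carries the model curve to gamma ([resonant_curve]). *)

(** * Coordinates and linear vector fields on R^4 *)

Section Coordinates.
Context {R : realType}.
Implicit Types (v w p : 'cV[R]_4) (a b c d : R).

Lemma x1_vec4 a b c d : x1 (vec4 a b c d) = a. Proof. by rewrite /x1 mxE. Qed.
Lemma x2_vec4 a b c d : x2 (vec4 a b c d) = b. Proof. by rewrite /x2 mxE. Qed.
Lemma x3_vec4 a b c d : x3 (vec4 a b c d) = c. Proof. by rewrite /x3 mxE. Qed.
Lemma x4_vec4 a b c d : x4 (vec4 a b c d) = d. Proof. by rewrite /x4 mxE. Qed.
Lemma x1D v w : x1 (v + w) = x1 v + x1 w. Proof. by rewrite /x1 mxE. Qed.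
Lemma x2D v w : x2 (v + w) = x2 v + x2 w. Proof. by rewrite /x2 mxE. Qed.
Lemma x3D v w : x3 (v + w) = x3 v + x3 w. Proof. by rewrite /x3 mxE. Qed.
Lemma x4D v w : x4 (v + w) = x4 v + x4 w. Proof. by rewrite /x4 mxE. Qed.
Lemma x1N v : x1 (- v) = - x1 v. Proof. by rewrite /x1 mxE. Qed.
Lemma x2N v : x2 (- v) = - x2 v. Proof. by rewrite /x2 mxE. Qed.
Lemma x3N v : x3 (- v) = - x3 v. Proof. by rewrite /x3 mxE. Qed.
Lemma x4N v : x4 (- v) = - x4 v. Proof. by rewrite /x4 mxE. Qed.
Lemma x1Z a v : x1 (a *: v) = a * x1 v. Proof. by rewrite /x1 mxE. Qed.
Lemma x2Z a v : x2 (a *: v) = a * x2 v. Proof. by rewrite /x2 mxE. Qed.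
Lemma x3Z a v : x3 (a *: v) = a * x3 v. Proof. by rewrite /x3 mxE. Qed.
Lemma x4Z a v : x4 (a *: v) = a * x4 v. Proof. by rewrite /x4 mxE. Qed.

Definition xE := (x1_vec4, x2_vec4, x3_vec4, x4_vec4, x1D, x2D, x3D, x4D,
  x1N, x2N, x3N, x4N, x1Z, x2Z, x3Z, x4Z).

Lemma vec4P v w :
  x1 v = x1 w -> x2 v = x2 w -> x3 v = x3 w -> x4 v = x4 w -> v = w.
Proof.
move=> h1 h2 h3 h4; apply/colP => -[[|[|[|[|//]]]] hi];
  by rewrite (bool_irrelevance hi isT).
Qed.
End Coordinates.

Section LinearFields.
Context {R : realType}.
Implicit Types (p v : 'cV[R]_4) (f : 'cV[R]_4 -> 'cV[R]_4).

(** Read off from the derivative of the identity map, entry by entry. *)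
Lemma is_derive_coord (i : 'I_4) p v :
  is_derive p v (fun q : 'cV[R]_4 => q i ord0 : R) (v i ord0).
Proof.
have di : derivable (fun q : 'cV[R]_4 => q) p v := @derivable_id _ _ p v.
apply: DeriveDef; first by move/derivable_mxP : di; apply.
by have := @derive_id _ _ p v; rewrite derive_mx// => /colP/(_ i); rewrite mxE.
Qed.

Lemma linear_sum_coord f : linear f ->
  f = \sum_(i < 4) (fun q : 'cV[R]_4 => q i ord0 *: f (delta_mx i ord0)).
Proof.
move=> lf; pose L : {linear 'cV[R]_4 -> 'cV[R]_4} :=
  HB.pack f (GRing.isLinear.Build _ _ _ _ f lf).
apply/funext => q; rewrite fct_sumE [in LHS](matrix_sum_delta q) -[f]/(L : _ -> _).
rewrite linear_sum; apply: eq_bigr => i _.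
by rewrite big_ord1 linearZ.
Qed.

Lemma differentiable_linear f p : linear f -> differentiable f p.
Proof.
move=> lf; rewrite (linear_sum_coord f lf); apply: differentiable_sum => i.
exact/differentiableZl/differentiable_coord.
Qed.

Lemma derive_linear f p v : linear f -> 'D_v f p = f v.
Proof.
move=> lf; rewrite deriveE; last exact: differentiable_linear.
pose L : {linear 'cV[R]_4 -> 'cV[R]_4} :=
  HB.pack f (GRing.isLinear.Build _ _ _ _ f lf).
rewrite -[f]/(L : _ -> _) diff_lin// => q.
exact/differentiable_continuous/differentiable_linear.
Qed.

Lemma smooth_cst (w : 'cV[R]_4) : smooth (fun=> w).
Proof.
move=> k; elim: k w => [//|k IH] w; split=> [p|v]; first exact: differentiable_cst.
rewrite (_ : 'D_v _ = fun=> 0); first exact: IH.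
by apply/funext => p; exact: derive_cst.
Qed.

Lemma smooth_linear f : linear f -> smooth f.
Proof.
move=> lf [//|k]; split=> [p|v]; first exact: differentiable_linear.
rewrite (_ : 'D_v f = fun=> f v); first exact: smooth_cst.
by apply/funext => p; exact: derive_linear.
Qed.
End LinearFields.

(** * The orthonormal frame *)

Section Frame.
Context {R : realType} (tau : R).
Implicit Types (p q t : 'cV[R]_4).

Definition frame_field (u1 u2 u3 : R) q : 'cV[R]_4 :=
  u1 *: E1 tau q + u2 *: E2 q + u3 *: E3 q.

Ltac coords := apply: vec4P; rewrite /frame_field /E1 /E2 /E3 /X1 /X2 /X3 ?xE.

Lemma frame_field_linear u1 u2 u3 : linear (frame_field u1 u2 u3).
Proof. by move=> k v w; coords; ring. Qed.

Lemma frame_fieldB u1 u2 u3 v1 v2 v3 q :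
  frame_field u1 u2 u3 q - frame_field v1 v2 v3 q =
  frame_field (u1 - v1) (u2 - v2) (u3 - v3) q.
Proof. by rewrite /frame_field !scalerBl; coords; ring. Qed.

Lemma frame_field0 q : frame_field 0 0 0 q = 0.
Proof. by rewrite /frame_field !scale0r !addr0. Qed.

Lemma inner_frame_field u1 u2 u3 p : inner p (frame_field u1 u2 u3 p) = 0.
Proof. by rewrite /inner /frame_field /E1 /E2 /E3 /X1 /X2 /X3 !xE; ring. Qed.

Lemma vfield_frame_field u1 u2 u3 : vfield (frame_field u1 u2 u3).
Proof.
split=> [|p _]; last exact: inner_frame_field.
exact: smooth_linear (frame_field_linear _ _ _).
Qed.

(** Off SL(2,R) the frame is not orthonormal.  Its metric coefficients are
    functions of the quadratic form alone, which is constant on SL(2,R); this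
    is why their derivatives in tangent directions vanish below. *)
Lemma metric_frame_fieldE u1 u2 u3 v1 v2 v3 q :
  metric tau q (frame_field u1 u2 u3 q) (frame_field v1 v2 v3 q) =
    (u2 * v2 + u3 * v3 - tau^-1 ^+ 2 * u1 * v1) * inner q q +
    (1 + tau ^+ 2) * tau^-1 ^+ 2 * u1 * v1 * inner q q ^+ 2.
Proof.
by rewrite /metric /inner /frame_field /E1 /E2 /E3 /X1 /X2 /X3 !xE; ring.
Qed.

Lemma metric_frame_field (tau0 : tau != 0) p u1 u2 u3 v1 v2 v3 : SL2 p ->
  metric tau p (frame_field u1 u2 u3 p) (frame_field v1 v2 v3 p) =
  u1 * v1 + u2 * v2 + u3 * v3.
Proof. by rewrite metric_frame_fieldE => ->; field. Qed.

Lemma derive_metric_frame_field u1 u2 u3 v1 v2 v3 w1 w2 w3 p :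
  'D_(frame_field u1 u2 u3 p)
     (fun q => metric tau q (frame_field v1 v2 v3 q)
                            (frame_field w1 w2 w3 q)) p = 0.
Proof.
under eq_fun do rewrite metric_frame_fieldE.
set k := _ - _; set l := _ * w1; set v := frame_field _ _ _ p.
have D1 : is_derive p v (@x1 R) (x1 v) := is_derive_coord _ _ _.
have D2 : is_derive p v (@x2 R) (x2 v) := is_derive_coord _ _ _.
have D3 : is_derive p v (@x3 R) (x3 v) := is_derive_coord _ _ _.
have D4 : is_derive p v (@x4 R) (x4 v) := is_derive_coord _ _ _.
have DQ : is_derive p v (fun q => inner q q) 0.
  have H := is_deriveB (is_deriveB (is_deriveD (is_deriveM D1 D1)
    (is_deriveM D2 D2)) (is_deriveM D3 D3)) (is_deriveM D4 D4).
  apply: (is_derive_eq H) => {H}.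
  have := inner_frame_field u1 u2 u3 p.
  by rewrite /inner -/v /GRing.scale/= => H; lra.
have H := is_deriveD (is_deriveM (is_derive_cst k p v) DQ)
  (is_deriveM (is_derive_cst l p v) (is_deriveM DQ DQ)).
have {H}H : is_derive p v
    (fun q => k * inner q q + l * inner q q ^+ 2) 0.
  by apply: (is_derive_eq H); rewrite /GRing.scale/=; ring.
exact: derive_val.
Qed.

Lemma E1_frame_field : E1 tau = frame_field 1 0 0.
Proof. by apply/funext => q; coords; ring. Qed.

Lemma E2_frame_field : @E2 R = frame_field 0 1 0.
Proof. by apply/funext => q; coords; ring. Qed.

Lemma E3_frame_field : @E3 R = frame_field 0 0 1.
Proof. by apply/funext => q; coords; ring. Qed.

(** For p in SL(2,R), the vectors p, X1, X2, X3 form an orthonormal basis of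
    signature (+, +, -, -), and a tangent vector has no component along p. *)
Lemma tangent_frame_field (tau0 : tau != 0) p t : SL2 p -> inner p t = 0 ->
  t = frame_field (metric tau p t (E1 tau p)) (metric tau p t (E2 p))
          (metric tau p t (E3 p)) p.
Proof.
move=> Qp pt.
have -> : metric tau p t (E1 tau p) = - tau * inner t (X1 p) * inner p p.
  rewrite (_ : metric _ _ _ _ = tau^-1 * inner t (X1 p) *
    (1 - (1 + tau ^+ 2) * inner p p)).
    by rewrite Qp; field.
  by rewrite /metric /inner /E1 /X1 !xE; ring.
have -> : metric tau p t (E2 p) = - inner t (X2 p).
  by rewrite /metric /inner /E2 /X1 /X2 !xE; ring.
have -> : metric tau p t (E3 p) = - inner t (X3 p).
  by rewrite /metric /inner /E3 /X1 /X3 !xE; ring.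
(* Write t as <p, p> t - <p, t> p, which makes the equality a polynomial
   identity in the coordinates of p and t. *)
rewrite -[LHS]scale1r -[LHS]subr0 -[0](scale0r p) -pt -Qp Qp mulr1 -Qp.
by rewrite /inner; coords; field.
Qed.

Lemma lie_frame_field (tau0 : tau != 0) u1 u2 u3 v1 v2 v3 :
  lie (frame_field u1 u2 u3) (frame_field v1 v2 v3) =
  frame_field (2 * tau * (u2 * v3 - u3 * v2)) (2 / tau * (u1 * v3 - u3 * v1))
      (2 / tau * (u2 * v1 - u1 * v2)).
Proof.
apply/funext => q; rewrite /lie !derive_linear; do ?exact: frame_field_linear.
by coords; field.
Qed.

Lemma frame_field_inj (tau0 : tau != 0) p u1 u2 u3 : SL2 p ->
  frame_field u1 u2 u3 p = 0 ->
  [/\ u1 = 0, u2 = 0 & u3 = 0].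
Proof.
move=> Qp u0.
have H v1 v2 v3 : u1 * v1 + u2 * v2 + u3 * v3 = 0.
  rewrite -(metric_frame_field tau0 _ _ _ _ _ _ _ Qp) u0.
  rewrite /metric /inner -(scale0r p) !xE.
  by ring.
by split; [have := H 1 0 0|have := H 0 1 0|have := H 0 0 1] => <-; ring.
Qed.
End Frame.

(** * The Levi-Civita connection and its curvature *)

Section Connection.
Context {R : realType} (tau : R) (tau0 : tau != 0).
Variable nabla : ('cV[R]_4 -> 'cV[R]_4) -> ('cV[R]_4 -> 'cV[R]_4) ->
  'cV[R]_4 -> 'cV[R]_4.
Hypothesis hnabla : levi_civita tau nabla.
Implicit Types (p q : 'cV[R]_4).
Notation frame_field := (frame_field tau).

Let m := 2 / tau + tau.

(** Koszul's formula: three instances of metric compatibility and three of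
    torsion freeness determine the connection linearly. *)
Lemma metric_nabla_frame_field u1 u2 u3 v1 v2 v3 w1 w2 w3 p : SL2 p ->
  metric tau p (nabla (frame_field u1 u2 u3) (frame_field v1 v2 v3) p)
    (frame_field w1 w2 w3 p) =
    tau * (u2 * v3 - u3 * v2) * w1 + (m * u1 * v3 + tau * u3 * v1) * w2
    - (m * u1 * v2 + tau * u2 * v1) * w3.
Proof.
move=> Qp; have V a b c := vfield_frame_field tau a b c.
have C x y : metric tau p x y = metric tau p y x.
  by rewrite /metric /inner; ring.
have A x y z : metric tau p (x - y) z = metric tau p x z - metric tau p y z.
  by rewrite /metric /inner !xE; ring.
(* Metric compatibility, whose left hand side vanishes because the metric
   coefficients are constant along SL(2,R). *)
have M a1 a2 a3 b1 b2 b3 c1 c2 c3 :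
    metric tau p (nabla (frame_field a1 a2 a3) (frame_field b1 b2 b3) p)
      (frame_field c1 c2 c3 p) +
    metric tau p (nabla (frame_field a1 a2 a3) (frame_field c1 c2 c3) p)
      (frame_field b1 b2 b3 p) = 0.
  rewrite [X in _ + X]C -(lc_metric hnabla (V _ _ _) (V _ _ _) (V _ _ _) Qp).
  exact: derive_metric_frame_field.
have T a1 a2 a3 b1 b2 b3 c1 c2 c3 :
    metric tau p (nabla (frame_field a1 a2 a3) (frame_field b1 b2 b3) p)
      (frame_field c1 c2 c3 p) -
    metric tau p (nabla (frame_field b1 b2 b3) (frame_field a1 a2 a3) p)
      (frame_field c1 c2 c3 p) =
    2 * tau * (a2 * b3 - a3 * b2) * c1 + 2 / tau * (a1 * b3 - a3 * b1) * c2 +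
    2 / tau * (a2 * b1 - a1 * b2) * c3.
  rewrite -A (lc_torsion_free hnabla (V _ _ _) (V _ _ _) Qp) lie_frame_field//.
  by rewrite metric_frame_field//.
have := T u1 u2 u3 v1 v2 v3 w1 w2 w3.
have := T v1 v2 v3 w1 w2 w3 u1 u2 u3.
have := T w1 w2 w3 u1 u2 u3 v1 v2 v3.
have := M u1 u2 u3 v1 v2 v3 w1 w2 w3.
have := M v1 v2 v3 u1 u2 u3 w1 w2 w3.
have := M w1 w2 w3 v1 v2 v3 u1 u2 u3.
rewrite /m; lra.
Qed.

Lemma nabla_frame_field u1 u2 u3 v1 v2 v3 p : SL2 p ->
  nabla (frame_field u1 u2 u3) (frame_field v1 v2 v3) p =
  frame_field (tau * (u2 * v3 - u3 * v2)) (m * u1 * v3 + tau * u3 * v1)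
      (- (m * u1 * v2 + tau * u2 * v1)) p.
Proof.
move=> Qp; have V a b c := vfield_frame_field tau a b c.
have [_ /(_ p Qp) tg] := lc_vfield hnabla (V u1 u2 u3) (V v1 v2 v3).
rewrite {1}(tangent_frame_field tau tau0 _ _ Qp tg).
rewrite E1_frame_field (E2_frame_field tau) (E3_frame_field tau).
by rewrite !metric_nabla_frame_field//; congr (frame_field _ _ _ p); ring.
Qed.

(** Constant coefficient fields are their own extensions, so the curvature and
    the derivative along a curve only involve the connection on such fields. *)
Lemma frame_ext_frame_field p u1 u2 u3 : SL2 p ->
  frame_ext tau p (frame_field u1 u2 u3 p) = frame_field u1 u2 u3.
Proof using tau0.
move=> Qp; apply/funext => q.
rewrite /frame_ext !big_ord_recl big_ord0 /frame /= addr0.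
rewrite E1_frame_field (E2_frame_field tau) (E3_frame_field tau).
rewrite !metric_frame_field// /frame_field /E1 /E2 /E3.
by apply: vec4P; rewrite /X1 /X2 /X3 !xE; ring.
Qed.

(** The curvature operator is diagonal on the planes of the frame, with
    sectional curvature tau^2 on the planes containing E1 and
    - (4 + 3 tau^2) on the plane of E2 and E3. *)
Lemma curvature_frame_field p u1 u2 u3 v1 v2 v3 w1 w2 w3 : SL2 p ->
  curvature tau nabla p (frame_field u1 u2 u3 p) (frame_field v1 v2 v3 p)
    (frame_field w1 w2 w3 p) =
  let K := - (4 + 3 * tau ^+ 2) in
  let c12 := tau ^+ 2 * (u1 * v2 - u2 * v1) in
  let c13 := tau ^+ 2 * (u1 * v3 - u3 * v1) in
  let c23 := K * (u2 * v3 - u3 * v2) in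
  frame_field (c12 * w2 + c13 * w3) (c23 * w3 - c12 * w1)
    (- (c13 * w1 + c23 * w2)) p.
Proof.
move=> Qp; have V a b c := vfield_frame_field tau a b c.
have W a1 a2 a3 b1 b2 b3 := lc_vfield hnabla (V a1 a2 a3) (V b1 b2 b3).
have N a1 a2 a3 b1 b2 b3 c1 c2 c3 :=
  lc_ext hnabla (V a1 a2 a3) (V a1 a2 a3) (W b1 b2 b3 c1 c2 c3) (V _ _ _)
   (fun _ _ => erefl) (nabla_frame_field b1 b2 b3 c1 c2 c3) Qp.
rewrite /curvature !frame_ext_frame_field// lie_frame_field//.
rewrite !N !nabla_frame_field//= /m /frame_field /E1 /E2 /E3.
by apply: vec4P; rewrite /X1 /X2 /X3 !xE; field.
Qed.

(** Since V is only known on the open set I, its coefficients are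
    differentiated after replacing it by the given expression near s. *)
Lemma cov_along_frame_field (I : set R) (I_open : open I)
    (gamma V : R -> 'cV[R]_4) (T1 T2 T3 V1 V2 V3 : R -> R) :
  (forall s, I s -> SL2 (gamma s)) ->
  (forall s, I s ->
     derive1 gamma s = frame_field (T1 s) (T2 s) (T3 s) (gamma s)) ->
  (forall s, I s -> V s = frame_field (V1 s) (V2 s) (V3 s) (gamma s)) ->
  forall s, I s -> cov_along tau nabla gamma V s =
    frame_field (derive1 V1 s + tau * (T2 s * V3 s - T3 s * V2 s))
        (derive1 V2 s + (m * T1 s * V3 s + tau * T3 s * V1 s))
        (derive1 V3 s - (m * T1 s * V2 s + tau * T2 s * V1 s)) (gamma s).
Proof.
move=> Q dT dV s Is.
have D w1 w2 w3 : derive1 (fun t => metric tau (gamma t) (V t)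
    (frame_field w1 w2 w3 (gamma t))) s =
  derive1 (fun t => V1 t * w1 + V2 t * w2 + V3 t * w3) s.
  rewrite !derive1E; apply: near_eq_derive.
  near=> t; have It : I t by near: t; apply: open_nbhs_nbhs; split.
  by rewrite dV// metric_frame_field//; exact: Q.
have Qs := Q _ Is.
rewrite /cov_along !big_ord_recl big_ord0 /frame /=.
rewrite dT// frame_ext_frame_field// dV//.
rewrite E1_frame_field (E2_frame_field tau) (E3_frame_field tau).
rewrite !D !nabla_frame_field// !metric_frame_field//.
have -> : (fun r => V1 r * 1 + V2 r * 0 + V3 r * 0) = V1.
  by apply/funext => r; ring.
have -> : (fun r => V1 r * 0 + V2 r * 1 + V3 r * 0) = V2.
  by apply/funext => r; ring.
have -> : (fun r => V1 r * 0 + V2 r * 0 + V3 r * 1) = V3.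
  by apply/funext => r; ring.
rewrite addr0 /frame_field /E1 /E2 /E3.
by apply: vec4P; rewrite /X1 /X2 /X3 !xE; ring.
Unshelve. all: by end_near. Qed.
End Connection.

(** * Functions of one real variable *)

Section RealFunctions.
Context {R : realType}.
Implicit Types (f g : R -> R) (x a b k : R).

Lemma is_derive1M f g x a b : is_derive x 1 f a -> is_derive x 1 g b ->
  is_derive x 1 (fun t => f t * g t) (a * g x + f x * b).
Proof.
move=> fa gb; apply: (is_derive_eq (is_deriveM fa gb)).
by rewrite /GRing.scale/=; ring.
Qed.

Lemma is_derive1Ml k f x a : is_derive x 1 f a ->
  is_derive x 1 (fun t => k * f t) (k * a).
Proof. by move=> fa; apply: (is_derive_eq (is_deriveZ k fa)). Qed.

Lemma is_derive1_sin f x a : is_derive x 1 f a ->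
  is_derive x 1 (fun t => sin (f t)) (cos (f x) * a).
Proof. by move=> fa; exact: (is_derive1_comp (is_derive_sin (f x)) fa). Qed.

Lemma is_derive1_cos f x a : is_derive x 1 f a ->
  is_derive x 1 (fun t => cos (f t)) (- sin (f x) * a).
Proof. by move=> fa; exact: (is_derive1_comp (is_derive_cos (f x)) fa). Qed.

Lemma derivable_is_derive1 f x : derivable f x 1 -> is_derive x 1 f (derive1 f x).
Proof. by move=> fx; rewrite derive1E; exact: derivableP. Qed.

Lemma is_derive1_val f x a : is_derive x 1 f a -> derive1 f x = a.
Proof. by move=> fa; rewrite derive1E; exact: derive_val. Qed.

Lemma derive1_near (I : set R) f g s : open I -> I s ->
  (forall t, I t -> f t = g t) -> derive1 f s = derive1 g s.
Proof.
move=> oI Is fg; rewrite !derive1E; apply: near_eq_derive.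
near=> t; apply: fg; near: t; apply: open_nbhs_nbhs; split => //.
Unshelve. all: by end_near. Qed.

Lemma is_derive0_cst_itv (I : set R) f : is_interval I ->
  (forall s, I s -> is_derive s 1 f 0) ->
  forall s t, I s -> I t -> f s = f t.
Proof.
move=> iI df; suff H s t : s <= t -> I s -> I t -> f s = f t.
  by move=> s t Is It; case/orP: (le_total s t) => st; [|symmetry]; exact: H.
move=> st Is It.
have Ist x : x \in `[s, t]%R -> I x by rewrite in_itv/=; exact: iI.
have dst x : x \in `]s, t[%R -> is_derive x 1 f 0.
  by move=> /subset_itv_oo_cc/Ist; exact: df.
have cst : {within `[s, t], continuous f}.
  by apply: derivable_within_continuous => x /Ist /df [].
have [x _ /eqP] := @MVT_segment R f (fun=> 0) s t st dst cst.
by rewrite mul0r subr_eq0 => /eqP.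
Qed.

Lemma is_derive_cst_affine_itv (I : set R) f g : is_interval I ->
  (forall s, I s -> is_derive s 1 f (g s)) ->
  (forall s, I s -> is_derive s 1 g 0) ->
  forall s t, I s -> I t -> f s - s * g s = f t - t * g t.
Proof.
move=> iI df dg; apply: is_derive0_cst_itv => // s Is.
have H := is_deriveB (df s Is) (is_derive1M _ _ _ _ _ (is_derive_id s 1) (dg s Is)).
by apply: (is_derive_eq H); ring.
Qed.
End RealFunctions.

(** * The bitension field of the curve *)

Section Biharmonic.
Context {R : realType} (tau : R) (tau0 : tau != 0).
Variable nabla : ('cV[R]_4 -> 'cV[R]_4) -> ('cV[R]_4 -> 'cV[R]_4) ->
  'cV[R]_4 -> 'cV[R]_4.
Hypothesis hnabla : levi_civita tau nabla.
Variables (I : set R) (I_open : open I) (I_itv : is_interval I).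
Variables (gamma : R -> 'cV[R]_4) (beta : R -> R) (c sg : R).
Hypothesis gamma_SL2 : forall s, I s -> SL2 (gamma s).
Hypothesis beta_smooth : smooth_on I beta.
Hypothesis dgamma : forall s, I s -> derive1 gamma s =
  frame_field tau c (sg * sin (beta s)) (sg * cos (beta s)) (gamma s).
Notation frame_field := (frame_field tau).

Let m := 2 / tau + tau.
Let db := derive1 beta.
Let ddb := derive1 db.
(** The curvature of gamma with respect to the unit normal
    cos beta E2 - sin beta E3, by [velocity_derivative]. *)
Definition signed_curvature s := sg * (db s + c * (m + tau)).

Let is_db s : I s -> is_derive s 1 beta (db s).
Proof. by move=> Is; apply: derivable_is_derive1; exact: (beta_smooth 0%N). Qed.

Let is_ddb s : I s -> is_derive s 1 db (ddb s).
Proof. by move=> Is; apply: derivable_is_derive1; exact: (beta_smooth 1%N). Qed.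

Lemma is_derive_signed_curvature s : I s -> is_derive s 1 signed_curvature (sg * ddb s).
Proof.
move=> Is; apply: is_derive1Ml.
have H := is_deriveD (is_ddb _ Is) (is_derive_cst (c * (m + tau)) s (1 : R)).
by apply: (is_derive_eq H); rewrite addr0.
Qed.

Lemma velocity_derivative s : I s -> cov_along tau nabla gamma (derive1 gamma) s =
  frame_field 0 (signed_curvature s * cos (beta s))
    (- signed_curvature s * sin (beta s)) (gamma s).
Proof.
move=> Is; rewrite (cov_along_frame_field tau tau0 nabla hnabla I I_open
  _ _ _ _ _ _ _ _ gamma_SL2 dgamma dgamma)//.
rewrite (is_derive1_val _ _ _ (is_derive_cst c s (1 : R))).
rewrite (is_derive1_val _ _ _
  (is_derive1Ml _ _ _ _ (is_derive1_sin _ _ _ (is_db _ Is)))).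
rewrite (is_derive1_val _ _ _
  (is_derive1Ml _ _ _ _ (is_derive1_cos _ _ _ (is_db _ Is)))).
by congr (frame_field _ _ _ _); rewrite /signed_curvature /m; field.
Qed.

Lemma velocity_derivative2 s : I s ->
  cov_along tau nabla gamma (cov_along tau nabla gamma (derive1 gamma)) s =
  frame_field (- (tau * sg) * signed_curvature s)
    (sg * ddb s * cos (beta s) - (db s + m * c) * signed_curvature s * sin (beta s))
    (- (sg * ddb s) * sin (beta s) - (db s + m * c) * signed_curvature s * cos (beta s))
    (gamma s).
Proof.
move=> Is; rewrite (cov_along_frame_field tau tau0 nabla hnabla I I_open
  _ _ _ _ _ _ _ _ gamma_SL2 dgamma velocity_derivative)//.
have dk := is_derive_signed_curvature _ Is.
have dNk : is_derive s 1 (fun t => - signed_curvature t) (- (sg * ddb s)) :=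
  is_deriveN dk.
rewrite (is_derive1_val _ _ _ (is_derive_cst 0 s (1 : R))).
rewrite (is_derive1_val _ _ _
  (is_derive1M _ _ _ _ _ dk (is_derive1_cos _ _ _ (is_db _ Is)))).
rewrite (is_derive1_val _ _ _
  (is_derive1M _ _ _ _ _ dNk (is_derive1_sin _ _ _ (is_db _ Is)))).
congr (frame_field _ _ _ _); try by rewrite -/m; ring.
by rewrite -[RHS]mulr1 -(cos2Dsin2 (beta s)); ring.
Qed.

Lemma curvature_term s : I s ->
  curvature tau nabla (gamma s) (derive1 gamma s)
    (cov_along tau nabla gamma (derive1 gamma) s) (derive1 gamma s) =
  let k := signed_curvature s * ((4 + 3 * tau ^+ 2) * sg ^+ 2 - tau ^+ 2 * c ^+ 2) in
  frame_field 0 (k * cos (beta s)) (- k * sin (beta s)) (gamma s).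
Proof.
move=> Is; rewrite velocity_derivative// dgamma//.
rewrite curvature_frame_field//=; last exact: gamma_SL2.
have E : cos (beta s) ^+ 2 + sin (beta s) ^+ 2 = 1 := cos2Dsin2 _.
set k := signed_curvature s; set C := cos (beta s) in E *; set S := sin (beta s) in E *.
congr (frame_field _ _ _ _); first by ring.
- by have := congr1 ( *%R ((4 + 3 * tau ^+ 2) * sg ^+ 2 * k * C)) E; lra.
- by have := congr1 ( *%R ((4 + 3 * tau ^+ 2) * sg ^+ 2 * k * S)) E; lra.
Qed.

(** The derivative of the E1 coefficient and the connection term contribute
    equally, and the curvature term is a multiple of the normal. *)
Lemma bitension_E1 s : I s -> exists y z,
  bitension tau nabla gamma s =
  frame_field (- (2 * tau * sg ^+ 2) * ddb s) y z (gamma s).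
Proof.
move=> Is; rewrite /bitension/= curvature_term//.
rewrite (cov_along_frame_field tau tau0 nabla hnabla I I_open
  _ _ _ _ _ _ _ _ gamma_SL2 dgamma velocity_derivative2)//.
rewrite (is_derive1_val _ _ _ (is_derive1Ml _ _ _ _ (is_derive_signed_curvature _ Is))).
rewrite frame_fieldB; do 2!eexists; congr (frame_field _ _ _ _).
have E : cos (beta s) ^+ 2 + sin (beta s) ^+ 2 = 1 := cos2Dsin2 _.
set C := cos (beta s) in E *; set S := sin (beta s) in E *.
by have := congr1 ( *%R (tau * sg ^+ 2 * ddb s)) E; lra.
Qed.

Hypothesis tau_sg : tau * sg != 0.
Hypothesis bih : proper_biharmonic tau nabla I gamma.

Lemma biharmonic_slope_cst s t : I s -> I t -> db s = db t.
Proof.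
apply: is_derive0_cst_itv => // {}s Is.
have [y [z]] := bitension_E1 _ Is; rewrite bih.1// => /esym.
move/(frame_field_inj _ tau0 _ _ _ _ (gamma_SL2 _ Is)) => [/eqP + _ _].
move: tau_sg; rewrite !mulf_eq0 negb_or => /andP[t0 sg0].
rewrite oppr_eq0 !mulf_eq0 pnatr_eq0/= (negPf t0) (negPf sg0)/= => /eqP ddb0.
by have := is_ddb _ Is; rewrite ddb0.
Qed.

(** Over the empty interval every curve is vacuously a geodesic. *)
Lemma proper_biharmonic_nonempty : exists s, I s.
Proof.
have [//|I0] := pselect (exists s, I s).
case: bih.2 => s Is; case: I0; by exists s.
Qed.

(** Normal component of the bitension field, divided by the curvature.  The
    curvature is constant along gamma by [biharmonic_slope_cst], so if it
    vanished at one point the curve would be a geodesic. *)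
Lemma biharmonic_slope_eq s : I s ->
  (db s + m * c) ^+ 2 = tau ^+ 2 * c ^+ 2 - 4 * (1 + tau ^+ 2) * sg ^+ 2.
Proof.
move=> Is; have ddb0 t : I t -> ddb t = 0.
  move=> It; rewrite /ddb (derive1_near I db (cst (db s)) t)//.
    by rewrite derive1_cst.
  by move=> r Ir /=; exact: biharmonic_slope_cst.
have k0 : signed_curvature s != 0.
  apply/negP => /eqP k0; apply: bih.2 => t It; rewrite velocity_derivative//.
  have -> : signed_curvature t = 0.
    by rewrite -k0 /signed_curvature (biharmonic_slope_cst _ _ It Is).
  by rewrite oppr0 !mul0r frame_field0.
pose q := db s + m * c.
have c2 t : I t ->
    cov_along tau nabla gamma (cov_along tau nabla gamma (derive1 gamma)) t =
    frame_field (- (tau * sg) * signed_curvature s)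
        (- (q * signed_curvature s) * sin (beta t))
        (- (q * signed_curvature s) * cos (beta t)) (gamma t).
  move=> It; rewrite velocity_derivative2// ddb0// /signed_curvature.
  rewrite (biharmonic_slope_cst _ _ It Is) -/q.
  by congr (frame_field _ _ _ _); ring.
have := bih.1 s Is; rewrite /bitension/= curvature_term//.
rewrite (cov_along_frame_field tau tau0 nabla hnabla I I_open
  _ _ _ _ _ _ _ _ gamma_SL2 dgamma c2)//.
rewrite (is_derive1_val _ _ _
  (is_derive1Ml _ _ _ _ (is_derive1_sin _ _ _ (is_db _ Is)))).
rewrite (is_derive1_val _ _ _
  (is_derive1Ml _ _ _ _ (is_derive1_cos _ _ _ (is_db _ Is)))).
rewrite frame_fieldB => /(frame_field_inj _ tau0 _ _ _ _ (gamma_SL2 _ Is)) [_].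
have E : cos (beta s) ^+ 2 + sin (beta s) ^+ 2 = 1 := cos2Dsin2 _.
have -> : db s = q - m * c by rewrite /q; ring.
rewrite -/m; set C := cos (beta s) in E *; set S := sin (beta s) in E *.
(* The E2 and E3 components are the normal component times cos beta and
   - sin beta; recombine them. *)
move=> eC eS; apply: (mulfI k0); rewrite -/q.
have := congr1 ( *%R (signed_curvature s * (q ^+ 2 - (tau ^+ 2 * c ^+ 2
  - 4 * (1 + tau ^+ 2) * sg ^+ 2)))) E.
by have := congr1 ( *%R C) eC; have := congr1 ( *%R S) eS; lra.
Qed.
End Biharmonic.

(** * Solving for the angle and the slope *)

Section Algebra.
Context {R : realType}.
Implicit Types tau c sg a b : R.

(** The last hypothesis is b^2 = 4 a.  It says b + 2 c / tau = 2 sg or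
    - 2 sg, and the biharmonic equation then becomes
    tau c = - (2 + tau^2) sg or tau c = (2 + tau^2) sg respectively; the signs
    of c and sg exclude the first case. *)
Lemma double_root_angle tau c sg b : 0 < tau -> 0 <= c -> 0 < sg ->
  c ^+ 2 + sg ^+ 2 = 1 ->
  (b + (2 / tau + tau) * c) ^+ 2 = tau ^+ 2 * c ^+ 2 - 4 * (1 + tau ^+ 2) * sg ^+ 2 ->
  b ^+ 2 = 4 * (1 - c ^+ 2 * (1 + tau ^- 2) - tau^-1 * c * b) ->
  tau * c = (2 + tau ^+ 2) * sg /\ b = - 2 * (tau^-1 * c + sg).
Proof.
move=> t0 c0 s0 E Eq Eb; have tn : tau != 0 by rewrite gt_eqF.
have F : (b + 2 * (tau^-1 * c)) ^+ 2 = (2 * sg) ^+ 2.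
  have -> : (2 * sg) ^+ 2 = 4 * (1 - c ^+ 2) by lra.
  rewrite (_ : (b + _) ^+ 2 = b ^+ 2 + 4 * tau^-1 * c * b + 4 * (tau ^- 2 * c ^+ 2)).
    by rewrite Eb; ring.
  by field.
have q c' : b + 2 * (tau^-1 * c) = c' ->
    tau ^+ 2 * c ^+ 2 - 4 * (1 + tau ^+ 2) * sg ^+ 2 = (c' + tau * c) ^+ 2.
  by move=> <-; rewrite -Eq; ring.
have tc : 0 <= tau * c by rewrite mulr_ge0// ltW.
have ts : 0 < tau ^+ 2 * sg by rewrite mulr_gt0// exprn_gt0.
move/eqP : F; rewrite eqf_sqr => /orP[] /eqP h.
  have := q _ h; have := mulr_gt0 s0 s0; have := mulr_gt0 ts s0.
  by have := mulr_ge0 tc (ltW s0); lra.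
split; last by lra.
by apply: (mulfI (lt0r_neq0 s0)); have := q _ h; lra.
Qed.
End Algebra.

(** * Complex linear maps in real coordinates *)

Section ComplexLinear.
Context {R : realType}.
Implicit Types (a b c d k : R) (v : 'cV[R]_4).

(** The complex matrix with rows (a1 + i a2, b1 + i b2) and
    (c1 + i c2, d1 + i d2), acting on the real coordinates of C^2. *)
Definition cmx a1 a2 b1 b2 c1 c2 d1 d2 : 'M[R]_4 :=
  \matrix_(i, j) nth 0 (nth [::]
    [:: [:: a1; - a2; b1; - b2]; [:: a2; a1; b2; b1];
        [:: c1; - c2; d1; - d2]; [:: c2; c1; d2; d1]] i) j.

Ltac mx4 := apply/matrixP => -[[|[|[|[|//]]]] ?] [[|[|[|[|//]]]] ?].

Lemma J1E : J1 R = cmx 0 1 0 0 0 0 0 1.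
Proof.
rewrite /J1 /block_mx /J2.
mx4; rewrite !mxE; case: splitP => -[[|[|//]] ?] //= _; rewrite !mxE;
  case: splitP => -[[|[|//]] ?] //= _; by rewrite !mxE ?oppr0.
Qed.

Lemma cmx_J1 a1 a2 b1 b2 c1 c2 d1 d2 (A := cmx a1 a2 b1 b2 c1 c2 d1 d2) :
  A *m J1 R = J1 R *m A.
Proof.
rewrite J1E /A; mx4; by rewrite !mxE !big_ord_recl !big_ord0 !mxE /=; ring.
Qed.

(** The hypotheses say that the columns of the complex matrix are orthogonal
    for the Hermitian form |z|^2 - |w|^2, with norms 1 and -1. *)
Lemma cmx_O24 a1 a2 b1 b2 c1 c2 d1 d2 :
  a1 ^+ 2 + a2 ^+ 2 - c1 ^+ 2 - c2 ^+ 2 = 1 ->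
  b1 ^+ 2 + b2 ^+ 2 - d1 ^+ 2 - d2 ^+ 2 = -1 ->
  a1 * b1 + a2 * b2 = c1 * d1 + c2 * d2 ->
  a2 * b1 - a1 * b2 = c2 * d1 - c1 * d2 ->
  O24 (cmx a1 a2 b1 b2 c1 c2 d1 d2).
Proof.
move=> ha hb h1 h2; set A := cmx _ _ _ _ _ _ _ _.
have eps2 : epsilon R *m epsilon R = 1%:M.
  by rewrite /epsilon mul_mx_diag; mx4; rewrite !mxE /=; ring.
have AeA : A^T *m epsilon R *m A = epsilon R.
  rewrite /A /epsilon mul_mx_diag; mx4;
    rewrite !mxE !big_ord_recl !big_ord0 !mxE /=; lra.
have iA : (epsilon R *m A^T *m epsilon R) *m A = 1%:M.
  by rewrite -!mulmxA (mulmxA A^T) AeA.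
have uA : A \in unitmx by case: (mulmx1_unit iA).
split=> //; have -> : invmx A = epsilon R *m A^T *m epsilon R.
  by rewrite -[LHS]mul1mx -iA mulmxK.
by rewrite !mulmxA eps2 mul1mx -mulmxA eps2 mulmx1.
Qed.

Lemma cmx_vec4 a1 a2 b1 b2 c1 c2 d1 d2 y1 y2 y3 y4 :
  cmx a1 a2 b1 b2 c1 c2 d1 d2 *m vec4 y1 y2 y3 y4 =
  vec4 (a1 * y1 - a2 * y2 + b1 * y3 - b2 * y4)
       (a2 * y1 + a1 * y2 + b2 * y3 + b1 * y4)
       (c1 * y1 - c2 * y2 + d1 * y3 - d2 * y4)
       (c2 * y1 + c1 * y2 + d2 * y3 + d1 * y4).
Proof.
apply/colP => -[[|[|[|[|//]]]] ?];
  rewrite !mxE !big_ord_recl big_ord0 !mxE /=; ring.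
Qed.
End ComplexLinear.

(** * Integration of the curve *)

(** The system z' = sg (i z + e conj w), w' = sg (i w + e conj z) with
    e = C + i S of modulus 1.  Differentiating z' once more gives
    z'' = sg^2 (|e|^2 - 1) z = 0, so z - s z' is constant.  The system is
    symmetric in z and w, which is why z alone is treated. *)
Lemma nilpotent_system (R : realType) (I : set R) (I_itv : is_interval I)
    (z1 z2 w1 w2 : R -> R) (C S sg : R) : C ^+ 2 + S ^+ 2 = 1 ->
  (forall s, I s ->
    [/\ is_derive s 1 z1 (sg * (- z2 s + C * w1 s + S * w2 s)),
      is_derive s 1 z2 (sg * (z1 s + S * w1 s - C * w2 s)),
      is_derive s 1 w1 (sg * (- w2 s + C * z1 s + S * z2 s)) &
      is_derive s 1 w2 (sg * (w1 s + S * z1 s - C * z2 s))]) ->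
  forall s t, I s -> I t ->
    z1 s - s * (sg * (- z2 s + C * w1 s + S * w2 s)) =
      z1 t - t * (sg * (- z2 t + C * w1 t + S * w2 t)) /\
    z2 s - s * (sg * (z1 s + S * w1 s - C * w2 s)) =
      z2 t - t * (sg * (z1 t + S * w1 t - C * w2 t)).
Proof.
move=> E sys s t Is It; split.
- apply: (is_derive_cst_affine_itv I z1 (fun s => sg * (- z2 s + C * w1 s + S * w2 s)))
    => // {s t Is It} s Is; first by case: (sys s Is).
  have [d1 d2 d3 d4] := sys s Is.
  have H := is_derive1Ml sg _ _ _ (is_deriveD (is_deriveD (is_deriveN d2)
    (is_derive1Ml C _ _ _ d3)) (is_derive1Ml S _ _ _ d4)).
  apply: (is_derive_eq H).
  have := congr1 ( *%R (sg ^+ 2 * z1 s)) E; lra.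
- apply: (is_derive_cst_affine_itv I z2 (fun s => sg * (z1 s + S * w1 s - C * w2 s)))
    => // {s t Is It} s Is; first by case: (sys s Is).
  have [d1 d2 d3 d4] := sys s Is.
  have H := is_derive1Ml sg _ _ _ (is_deriveB (is_deriveD d1
    (is_derive1Ml S _ _ _ d3)) (is_derive1Ml C _ _ _ d4)).
  apply: (is_derive_eq H).
  have := congr1 ( *%R (sg ^+ 2 * z2 s)) E; lra.
Qed.

Section Helix.
Context {R : realType} (tau : R) (I : set R) (I_itv : is_interval I).
Variables (gamma : R -> 'cV[R]_4) (beta : R -> R) (c sg r : R).
Hypothesis gamma_smooth : smooth_on I gamma.
Hypothesis gamma_SL2 : forall s, I s -> SL2 (gamma s).
Hypothesis dgamma : forall s, I s -> derive1 gamma s =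
  frame_field tau c (sg * sin (beta s)) (sg * cos (beta s)) (gamma s).
Hypothesis rE : r = tau^-1 * c + sg.
Hypothesis dbeta : forall s, I s -> is_derive s 1 beta (- 2 * r).

Lemma is_derive_gamma s (i : 'I_4) : I s ->
  is_derive s 1 (fun t => gamma t i ord0 : R)
    (frame_field tau c (sg * sin (beta s)) (sg * cos (beta s)) (gamma s) i ord0).
Proof.
move=> Is; have dg : derivable gamma s 1 := gamma_smooth 0%N s Is.
apply: DeriveDef; first by move/derivable_mxP : dg; apply.
by rewrite -dgamma// derive1E derive_mx// mxE.
Qed.

Let phi s := beta s + 2 * r * s.

Let phi_cst s t : I s -> I t -> phi s = phi t.
Proof.
apply: is_derive0_cst_itv => // {}s Is.
have H := is_deriveD (dbeta _ Is) (is_derive1Ml (2 * r) id _ _ (is_derive_id s 1)).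
by apply: (is_derive_eq H); ring.
Qed.

(* Real and imaginary parts of e^(i r s) z and e^(i r s) w. *)
Let z1 s := cos (r * s) * x1 (gamma s) - sin (r * s) * x2 (gamma s).
Let z2 s := sin (r * s) * x1 (gamma s) + cos (r * s) * x2 (gamma s).
Let w1 s := cos (r * s) * x3 (gamma s) - sin (r * s) * x4 (gamma s).
Let w2 s := sin (r * s) * x3 (gamma s) + cos (r * s) * x4 (gamma s).

(** In e^(i r s) e^(i beta) conj w the two exponentials multiply to
    e^(i phi) e^(- i r s), so conj w gets rotated as the conjugate of the new
    w should be.  The rotation adds i r to the coefficient - i c / tau, and
    r - c / tau = sg. *)
Lemma rotated_curve_ode s0 s : I s0 -> I s ->
  let C := cos (phi s0) in let S := sin (phi s0) in
  [/\ is_derive s 1 z1 (sg * (- z2 s + C * w1 s + S * w2 s)),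
      is_derive s 1 z2 (sg * (z1 s + S * w1 s - C * w2 s)),
      is_derive s 1 w1 (sg * (- w2 s + C * z1 s + S * z2 s)) &
      is_derive s 1 w2 (sg * (w1 s + S * z1 s - C * z2 s))].
Proof.
move=> Is0 Is C S.
have D1 : is_derive s 1 (fun t => x1 (gamma t)) _ := is_derive_gamma s _ Is.
have D2 : is_derive s 1 (fun t => x2 (gamma t)) _ := is_derive_gamma s _ Is.
have D3 : is_derive s 1 (fun t => x3 (gamma t)) _ := is_derive_gamma s _ Is.
have D4 : is_derive s 1 (fun t => x4 (gamma t)) _ := is_derive_gamma s _ Is.
have Drs : is_derive s 1 (fun t : R => r * t) r.
  by apply: (is_derive_eq (is_derive1Ml r id _ _ (is_derive_id s 1))); rewrite mulr1.
have Dc := is_derive1_cos _ _ _ Drs.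
have Ds := is_derive1_sin _ _ _ Drs.
have Eb : r * s + beta s = phi s0 - r * s by rewrite (phi_cst s0 s)// /phi; ring.
set cb := cos (beta s); set sb := sin (beta s).
set ct := cos (r * s); set st := sin (r * s).
have Ec : ct * cb - st * sb = C * ct + S * st by rewrite -cosD Eb cosB.
have Es : st * cb + ct * sb = S * ct - C * st by rewrite -sinD Eb sinB.
have F y := (congr1 ( *%R (sg * y)) Es, congr1 ( *%R (sg * y)) Ec).
have [[F1s F1c] [F2s F2c]] := (F (x1 (gamma s)), F (x2 (gamma s))).
have [[F3s F3c] [F4s F4c]] := (F (x3 (gamma s)), F (x4 (gamma s))).
have rot u v du dv : is_derive s 1 u du -> is_derive s 1 v dv ->
  is_derive s 1 (fun t => cos (r * t) * u t - sin (r * t) * v t)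
    (ct * du - st * dv - r * (st * u s + ct * v s)) /\
  is_derive s 1 (fun t => sin (r * t) * u t + cos (r * t) * v t)
    (st * du + ct * dv + r * (ct * u s - st * v s)).
  move=> Du Dv; split.
    apply: (is_derive_eq (is_deriveB (is_derive1M _ _ _ _ _ Dc Du)
      (is_derive1M _ _ _ _ _ Ds Dv))).
    by rewrite -/ct -/st; ring.
  apply: (is_derive_eq (is_deriveD (is_derive1M _ _ _ _ _ Ds Du)
    (is_derive1M _ _ _ _ _ Dc Dv))).
  by rewrite -/ct -/st; ring.
have [Dz1 Dz2] := rot _ _ _ _ D1 D2.
have [Dw1 Dw2] := rot _ _ _ _ D3 D4.
split; [apply: (is_derive_eq Dz1)|apply: (is_derive_eq Dz2)
       |apply: (is_derive_eq Dw1)|apply: (is_derive_eq Dw2)];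
  rewrite -/(x1 _) -/(x2 _) -/(x3 _) -/(x4 _);
  rewrite /frame_field /E1 /E2 /E3 /X1 /X2 /X3 !xE;
  rewrite -/ct -/st -/cb -/sb rE /z1 /z2 /w1 /w2 -/ct -/st;
  clear -F1s F1c F2s F2c F3s F3c F4s F4c; lra.
Qed.

(** Undoing the rotation turns the affine solution into a combination of
    e^(- i r s) and s e^(- i r s), whose coefficients are the columns of A. *)
Lemma resonant_curve : (exists s, I s) -> exists A : 'M[R]_4,
  O24 A /\ A *m J1 R = J1 R *m A /\
  forall s, I s -> gamma s = A *m vec4
    (cos (r * s) + sg * s * sin (r * s))
    (- sin (r * s) + sg * s * cos (r * s))
    (- (sg * s * cos (r * s)))
    (sg * s * sin (r * s)).
Proof.
move=> [s0 Is0].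
set C := cos (phi s0); set S := sin (phi s0).
have E : C ^+ 2 + S ^+ 2 = 1 := cos2Dsin2 _.
have sys s : I s -> _ := fun Is => rotated_curve_ode s0 s Is0 Is.
have sys' s : I s -> [/\ is_derive s 1 w1 (sg * (- w2 s + C * z1 s + S * z2 s)),
    is_derive s 1 w2 (sg * (w1 s + S * z1 s - C * z2 s)),
    is_derive s 1 z1 (sg * (- z2 s + C * w1 s + S * w2 s)) &
    is_derive s 1 z2 (sg * (z1 s + S * w1 s - C * w2 s))].
  by case/sys.
(* The values at s = 0 of the affine solution, extrapolated from s0 since 0 may
   lie outside I. *)
set k1 := z1 s0 - s0 * (sg * (- z2 s0 + C * w1 s0 + S * w2 s0)).
set k2 := z2 s0 - s0 * (sg * (z1 s0 + S * w1 s0 - C * w2 s0)).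
set k3 := w1 s0 - s0 * (sg * (- w2 s0 + C * z1 s0 + S * z2 s0)).
set k4 := w2 s0 - s0 * (sg * (w1 s0 + S * z1 s0 - C * z2 s0)).
have rot_norm : z1 s0 ^+ 2 + z2 s0 ^+ 2 - w1 s0 ^+ 2 - w2 s0 ^+ 2 = 1.
  have := gamma_SL2 _ Is0; rewrite /SL2/= /inner => <-.
  rewrite -[RHS]mulr1 -(cos2Dsin2 (r * s0)) /z1 /z2 /w1 /w2; ring.
(* The vector field of the system is isotropic and orthogonal to the solution
   for the indefinite product, so extrapolation preserves the norm. *)
have k_norm : k1 ^+ 2 + k2 ^+ 2 - k3 ^+ 2 - k4 ^+ 2 = 1.
  have := congr1 ( *%R (s0 ^+ 2 * sg ^+ 2)) E.
  have := congr1 ( *%R (s0 ^+ 2 * sg ^+ 2 *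
    (z1 s0 ^+ 2 + z2 s0 ^+ 2 - w1 s0 ^+ 2 - w2 s0 ^+ 2))) E.
  rewrite /k1 /k2 /k3 /k4; lra.
have F y := congr1 ( *%R y) E.
(* Columns (k, l) and - e^(i phi) (conj l, conj k), where k = k1 + i k2 and
   l = k3 + i k4. *)
exists (cmx k1 k2 (- (C * k3 + S * k4)) (- (S * k3 - C * k4))
            k3 k4 (- (C * k1 + S * k2)) (- (S * k1 - C * k2))).
split; [|split=> [|s Is]]; last 1 first.
- have [K1 K2] := nilpotent_system _ _ I_itv _ _ _ _ _ _ _ E sys s s0 Is Is0.
  have [K3 K4] := nilpotent_system _ _ I_itv _ _ _ _ _ _ _ E sys' s s0 Is Is0.
  rewrite -/k1 -/k2 -/k3 -/k4 in K1 K2 K3 K4.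
  have Ez1 : z1 s = k1 + s * sg * (- k2 + C * k3 + S * k4).
    rewrite -K1 -K2 -K3 -K4; have := F (s ^+ 2 * sg ^+ 2 * z1 s); lra.
  have Ez2 : z2 s = k2 + s * sg * (k1 + S * k3 - C * k4).
    rewrite -K1 -K2 -K3 -K4; have := F (s ^+ 2 * sg ^+ 2 * z2 s); lra.
  have Ew1 : w1 s = k3 + s * sg * (- k4 + C * k1 + S * k2).
    rewrite -K1 -K2 -K3 -K4; have := F (s ^+ 2 * sg ^+ 2 * w1 s); lra.
  have Ew2 : w2 s = k4 + s * sg * (k3 + S * k1 - C * k2).
    rewrite -K1 -K2 -K3 -K4; have := F (s ^+ 2 * sg ^+ 2 * w2 s); lra.
  have unrot u v : u = cos (r * s) * (cos (r * s) * u - sin (r * s) * v)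
      + sin (r * s) * (sin (r * s) * u + cos (r * s) * v) /\
      v = - sin (r * s) * (cos (r * s) * u - sin (r * s) * v)
      + cos (r * s) * (sin (r * s) * u + cos (r * s) * v).
    by split; rewrite -[LHS]mulr1 -(cos2Dsin2 (r * s)); ring.
  have [U1 U2] := unrot (x1 (gamma s)) (x2 (gamma s)).
  have [U3 U4] := unrot (x3 (gamma s)) (x4 (gamma s)).
  rewrite cmx_vec4; apply: vec4P; rewrite !xE.
  + rewrite [LHS]U1 -/(z1 s) -/(z2 s) Ez1 Ez2; ring.
  + rewrite [LHS]U2 -/(z1 s) -/(z2 s) Ez1 Ez2; ring.
  + rewrite [LHS]U3 -/(w1 s) -/(w2 s) Ew1 Ew2; ring.
  + rewrite [LHS]U4 -/(w1 s) -/(w2 s) Ew1 Ew2; ring.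
- have := F (k1 ^+ 2 + k2 ^+ 2); have := F (k3 ^+ 2 + k4 ^+ 2).
  by move=> F3 F1; apply: cmx_O24; lra.
- exact: cmx_J1.
Qed.
End Helix.

(** * The theorem *)

Theorem theorem4p1 (R : realType) (tau : R) (htau : 0 < tau)
    (nabla : ('cV[R]_4 -> 'cV[R]_4) -> ('cV[R]_4 -> 'cV[R]_4) ->
             'cV[R]_4 -> 'cV[R]_4)
    (hnabla : levi_civita tau nabla)
    (I : set R) (I_open : open I) (I_itv : is_interval I)
    (gamma : R -> 'cV[R]_4) (gamma_smooth : smooth_on I gamma)
    (gamma_SL2 : forall s, I s -> SL2 (gamma s))
    (gamma_arc : arc_length tau I gamma)
    (gamma_bih : proper_biharmonic tau nabla I gamma)
    (theta : R) (htheta : 0 < theta <= pi / 2)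
    (beta : R -> R) (beta_smooth : smooth_on I beta)
    (gamma' : forall s, I s ->
       derive1 gamma s = cos theta *: E1 tau (gamma s)
                     + (sin theta * sin (beta s)) *: E2 (gamma s)
                     + (sin theta * cos (beta s)) *: E3 (gamma s)) :
  exists a b : R,
    (forall s, I s ->
       derive1 beta s = b /\
       1 / 2 * (- tau ^- 2 + 1 - (1 + tau ^- 2) * cos (2 * theta))
       - tau^-1 * cos theta * derive1 beta s = a) /\
    (b ^+ 2 = 4 * a ->
       b = - tau^-1 * (2 + tau ^+ 2) * cos theta
           + Num.sqrt ((4 + 5 * tau ^+ 2) * cos theta ^+ 2
                       - 4 * (1 + tau ^+ 2)) /\
       cos theta ^+ 2 = (2 + tau ^+ 2) ^+ 2 / (4 + 5 * tau ^+ 2 + tau ^+ 4) /\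
       let g14 := tau / Num.sqrt (4 + 5 * tau ^+ 2 + tau ^+ 4) in
       exists A : 'M[R]_4,
         O24 A /\ A *m J1 R = J1 R *m A /\
         forall s, I s ->
           gamma s = A *m vec4
             (cos (Num.sqrt a * s) + g14 * s * sin (Num.sqrt a * s))
             (- sin (Num.sqrt a * s) + g14 * s * cos (Num.sqrt a * s))
             (- (g14 * s * cos (Num.sqrt a * s)))
             (g14 * s * sin (Num.sqrt a * s))).
Proof.
have tau0 : tau != 0 by rewrite gt_eqF.
have /andP[th0 th2] := htheta.
have c0 : 0 <= cos theta.
  by apply: cos_ge0_pihalf; rewrite th2 andbT; have := pi_gt0 R; lra.
have s0 : 0 < sin theta.
  by apply: sin_gt0_pi; rewrite th0/=; have := pi_gt0 R; lra.
have E : cos theta ^+ 2 + sin theta ^+ 2 = 1 := cos2Dsin2 _.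
set c := cos theta in c0 E gamma' *; set sg := sin theta in s0 E gamma' *.
have ts0 : tau * sg != 0 by rewrite mulf_neq0// gt_eqF.
have [s1 Is1] := proper_biharmonic_nonempty tau nabla I gamma gamma_bih.
have slope_cst s : I s -> derive1 beta s = derive1 beta s1.
  by move=> Is; exact: (biharmonic_slope_cst tau tau0 nabla hnabla I I_open I_itv gamma
    beta c sg gamma_SL2 beta_smooth gamma').
have slope := biharmonic_slope_eq tau tau0 nabla hnabla I I_open I_itv gamma
  beta c sg gamma_SL2 beta_smooth gamma' ts0 gamma_bih s1 Is1.
set b := derive1 beta s1 in slope_cst slope.
exists (1 / 2 * (- tau ^- 2 + 1 - (1 + tau ^- 2) * cos (2 * theta))
        - tau^-1 * c * b), b.
split=> [s Is|]; first by rewrite slope_cst.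
have -> : 1 / 2 * (- tau ^- 2 + 1 - (1 + tau ^- 2) * cos (2 * theta))
    - tau^-1 * c * b = 1 - c ^+ 2 * (1 + tau ^- 2) - tau^-1 * c * b.
  by rewrite mulr_natl cos_mulr2n -/c; field.
set a := _ - _ * b => ab.
have [tc bE] := double_root_angle tau c sg b htau c0 s0 E slope ab.
(* As 4 + 5 tau^2 + tau^4 = (2 + tau^2)^2 + tau^2, the relation between c and
   sg makes it a square; this gives g14 = sg. *)
have D0 : 4 + 5 * tau ^+ 2 + tau ^+ 4 = (tau / sg) ^+ 2.
  have sg0 : sg != 0 by rewrite gt_eqF.
  apply: (mulIf (expf_neq0 2 sg0)); rewrite expr_div_n divfK ?expf_neq0//.
  rewrite [RHS](_ : _ = (tau * c) ^+ 2 + tau ^+ 2 * sg ^+ 2); last first.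
    by rewrite exprMn -mulrDr E mulr1.
  by rewrite tc; ring.
have ts : 0 < tau / sg by rewrite divr_gt0.
split; [|split].
- rewrite (_ : _ - 4 * (1 + tau ^+ 2) = (tau ^+ 2 * sg) ^+ 2).
    rewrite sqrtr_sqr ger0_norm ?mulr_ge0 ?exprn_ge0 ?ltW// bE.
    have -> : - tau^-1 * (2 + tau ^+ 2) * c = - 2 * (tau^-1 * c) - tau * c by field.
    by rewrite tc; ring.
  have -> : (4 + 5 * tau ^+ 2) * c ^+ 2 - 4 * (1 + tau ^+ 2) =
    (tau * c) ^+ 2 - 4 * (1 + tau ^+ 2) * sg ^+ 2.
    have := congr1 ( *%R (4 * (1 + tau ^+ 2))) E; lra.
  by rewrite tc; ring.
- rewrite D0 expr_div_n invf_div mulrA; apply: (mulfI (expf_neq0 2 tau0)).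
  by rewrite -exprMn tc; field.
- rewrite /=; have gE : tau / Num.sqrt (4 + 5 * tau ^+ 2 + tau ^+ 4) = sg.
    by rewrite D0 sqrtr_sqr gtr0_norm// invf_div mulrCA divff// mulr1.
  rewrite gE; have -> : Num.sqrt a = tau^-1 * c + sg.
    have four0 : (4 : R) != 0 by rewrite pnatr_eq0.
    have -> : a = (tau^-1 * c + sg) ^+ 2.
      by apply: (mulfI four0); rewrite -ab bE; ring.
    by rewrite sqrtr_sqr ger0_norm// addr_ge0 ?(ltW s0)// mulr_ge0// invr_ge0 ltW.
  apply: (resonant_curve tau I I_itv gamma beta c sg _ gamma_smooth
    gamma_SL2 gamma' erefl).
    move=> s Is; rewrite -bE -(slope_cst s Is).
    by apply: derivable_is_derive1; exact: (beta_smooth 0%N).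
  by exists s1.
Qed.
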